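(* Every graph $G$ satisfying $e(G)\ge\frac32 v(G)-1$ contains $K_4-e$ (the complete graph $K_4$ with one edge removed) as a minor.
   Context: All graphs are finite, simple and have at least one vertex; $v(G)$ and $e(G)$ denote the numbers of vertices and edges of $G$. *)

(* Defs.v *)
From mathcomp Require Import all_boot.
Set Implicit Arguments.
Unset Strict Implicit.
Unset Printing Implicit Defensive.

(* Finite simple graphs.  The empty graph is allowed here, since it can appear
   after deleting vertices; non-emptiness is a hypothesis where needed. *)
Record sgraph := SGraph {
  vertex :> finType;
  adj : rel vertex;
  adj_sym : symmetric adj;
  adj_irr : irreflexive adj }.

Definition nb_vertices (G : sgraph) : nat := #|G|.

Definition edges (G : sgraph) : {set {set G}} :=
  [set [set p.1; p.2] | p : G * G & adj p.1 p.2].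

Definition nb_edges (G : sgraph) : nat := #|edges G|.

Definition isomorphic (G H : sgraph) : Prop :=
  exists2 f : G -> H, bijective f & {mono f : x y / adj x y}.

Section Operations.
Variable G : sgraph.

Definition del_vertex_adj (x : G) : rel {z : G | z != x} :=
  [rel a b | adj (val a) (val b)].

Lemma del_vertex_sym x : symmetric (@del_vertex_adj x).
Proof. by move=> a b; rewrite /del_vertex_adj /= adj_sym. Qed.

Lemma del_vertex_irr x : irreflexive (@del_vertex_adj x).
Proof. by move=> a; rewrite /del_vertex_adj /= adj_irr. Qed.

Definition del_vertex (x : G) : sgraph :=
  SGraph (@del_vertex_sym x) (@del_vertex_irr x).

Definition del_edge_adj (x y : G) : rel G :=
  [rel a b | adj a b && ([set a; b] != [set x; y])].

Lemma del_edge_sym x y : symmetric (del_edge_adj x y).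
Proof. by move=> a b; rewrite /del_edge_adj /= adj_sym setUC. Qed.

Lemma del_edge_irr x y : irreflexive (del_edge_adj x y).
Proof. by move=> a; rewrite /del_edge_adj /= adj_irr. Qed.

Definition del_edge (x y : G) : sgraph :=
  SGraph (@del_edge_sym x y) (@del_edge_irr x y).

(* Contraction of the edge xy: y is removed and x, which stands for the merged
   vertex, inherits the neighbours of y; no loop or parallel edge is kept. *)
Definition contract_adj (x y : G) : rel {z : G | z != y} :=
  [rel a b | (a != b) &&
     [|| adj (val a) (val b),
         (val a == x) && adj y (val b) |
         (val b == x) && adj (val a) y]].

Lemma contract_sym x y : symmetric (@contract_adj x y).
Proof.
move=> a b; rewrite /contract_adj /= eq_sym (adj_sym (val a) (val b)).
by rewrite (adj_sym y (val b)) (adj_sym (val a) y) (orbC (_ && _)).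
Qed.

Lemma contract_irr x y : irreflexive (@contract_adj x y).
Proof. by move=> a; rewrite /contract_adj /= eqxx. Qed.

Definition contract (x y : G) : sgraph :=
  SGraph (@contract_sym x y) (@contract_irr x y).

End Operations.

(* [minor H G]: a graph isomorphic to H can be obtained from G by a sequence of
   vertex deletions, edge deletions and edge contractions. *)
Inductive minor (H : sgraph) : sgraph -> Prop :=
| minor_iso (G : sgraph) : isomorphic G H -> minor H G
| minor_del_vertex (G : sgraph) (x : G) : minor H (del_vertex x) -> minor H G
| minor_del_edge (G : sgraph) (x y : G) :
    adj x y -> minor H (del_edge x y) -> minor H G
| minor_contract (G : sgraph) (x y : G) :
    adj x y -> minor H (contract x y) -> minor H G.

Definition complete_adj (n : nat) : rel 'I_n := [rel i j | i != j].

Lemma complete_sym n : symmetric (@complete_adj n).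
Proof. by move=> i j; rewrite /complete_adj /= eq_sym. Qed.

Lemma complete_irr n : irreflexive (@complete_adj n).
Proof. by move=> i; rewrite /complete_adj /= eqxx. Qed.

Definition complete (n : nat) : sgraph :=
  SGraph (@complete_sym n) (@complete_irr n).

Definition K4_minus_e : sgraph :=
  @del_edge (complete 4) (ord0 : 'I_4) (ord_max : 'I_4).

(* Main.v *)
(* Contracting an edge whose ends have t common neighbours changes 2e - 3v by
   1 - 2t.  If some edge has t >= 2, then K_4 - e is a subgraph; if some edge
   has t = 0, contract it.  Otherwise every edge lies in exactly one triangle,
   and contracting a whole triangle (first an edge with t = 1, then one with
   t = 0) keeps 2e - 3v unchanged.  In each case the bound 2e - 3v >= -2
   persists on fewer vertices, and it fails for non-empty edgeless graphs.
   Edges are counted as arcs, each edge contributing two. *)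
Require Import Defs.
From mathcomp Require Import all_boot all_order all_algebra.
From mathcomp Require Import zify lra.
Import GRing.Theory Num.Theory.

Definition arcs (G : sgraph) : {set G * G} := [set p | adj p.1 p.2].

Definition common_nbrs {G : sgraph} (x y : G) : {set G} :=
  [set w | adj x w && adj y w].

Lemma adj_neq (G : sgraph) (x y : G) : adj x y -> x != y.
Proof. by apply: contraTneq => ->; rewrite adj_irr. Qed.

(** When arcs are grouped by their set of ends, the fibre over an edge contains the two distinct
    arcs [(a, b)] and [(b, a)]. *)
Lemma leq_double_edges_arcs (G : sgraph) : (2 * nb_edges G <= #|arcs G|)%N.
Proof.
pose ends (p : G * G) := [set p.1; p.2].
have edgesE : edges G = ends @: arcs G.
  by apply/setP=> e; apply/imsetP/imsetP; case=> p;
    rewrite ?inE => p_adj ->; exists p; rewrite ?inE.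
rewrite /nb_edges edgesE -[#|arcs G|]sum1_card (partition_big_imset ends) /=.
rewrite mulnC -sum_nat_const leq_sum // => e /imsetP[[a b]].
rewrite inE /= => ab ->.
have ba : adj b a by rewrite adj_sym.
rewrite sum1dep_card (cardD1 (a, b)) (cardD1 (b, a)).
rewrite !inE /= ab ba /ends /= eqxx setUC eqxx.
by rewrite xpair_eqE (negbTE (adj_neq _ _ _ ba)).
Qed.

Lemma card_del_vertex (G : sgraph) (x : G) : #|del_vertex x| = #|G|.-1.
Proof. by rewrite card_sig -(cardC1 x); apply: eq_card. Qed.

Lemma card_contract (G : sgraph) (x y : G) : #|contract x y| = #|G|.-1.
Proof. by rewrite card_sig -(cardC1 y); apply: eq_card. Qed.

Lemma card_arcs_del_vertex (G : sgraph) (x : G) :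
  (#|arcs (del_vertex x)| <= #|arcs G|)%N.
Proof.
pose h (p : del_vertex x * del_vertex x) := (val p.1, val p.2).
have h_inj : injective h by case=> a b [c d] [/val_inj-> /val_inj->].
rewrite -(card_imset _ h_inj) subset_leq_card //.
by apply/subsetP=> p /imsetP[q]; rewrite !inE => ? ->.
Qed.

Lemma card_arcs_del_edge (G : sgraph) (x y : G) :
  adj x y -> (#|arcs (del_edge x y)| < #|arcs G|)%N.
Proof.
move=> xy; apply: proper_card; apply/properP; split.
  by apply/subsetP=> p; rewrite !inE => /andP[].
by exists (x, y); rewrite inE //= /del_edge_adj /= eqxx andbF.
Qed.

(** Delete vertices outside the image of [f], then edges whose preimages are not adjacent. Each
    deletion lowers vertices plus arcs; when none is possible, [f] is an isomorphism. *)
Lemma subgraph_minor (H G : sgraph) (f : H -> G) :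
  injective f -> (forall a b, adj a b -> adj (f a) (f b)) -> minor H G.
Proof.
have [n] := ubnP (#|G| + #|arcs G|)%N.
elim: n G f => // n IHn G f leGn f_inj f_hom.
have [x xNf|f_onto] := pickP [pred x | x \notin codom f].
  have fNx a : f a != x by apply: contraNneq xNf => <-; apply: codom_f.
  apply: (minor_del_vertex (x := x)).
  apply: (IHn (del_vertex x) (fun a => exist _ (f a) (fNx a))) => [|a b [/f_inj]|] //.
  have := card_arcs_del_vertex _ x; rewrite card_del_vertex.
  by move: leGn; rewrite (cardD1 x) inE; lia.
have [|g fK gK] := inj_card_bij f_inj.
  rewrite -(card_codom f_inj) subset_leq_card //.
  by apply/subsetP=> x _; have /negbFE := f_onto x.
have [[a b] /= /andP[fab Nab]|f_refl] :=
    pickP [pred p : H * H | adj (f p.1) (f p.2) && ~~ adj p.1 p.2].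
  apply: (minor_del_edge fab); apply: (IHn (del_edge (f a) (f b)) f) => //.
    by have := card_arcs_del_edge _ _ _ fab; move: leGn => /=; lia.
  move=> c d cd; rewrite /= /del_edge_adj /= f_hom //=.
  (* If [f] sent the edge [cd] to the deleted edge, injectivity would give {c, d} = {a, b}, so [a]
     and [b] would be adjacent. *)
  apply: contraNneq Nab => E.
  have : f c \in [set f a; f b] by rewrite -E !inE eqxx.
  have : f d \in [set f a; f b] by rewrite -E !inE eqxx orbT.
  rewrite !inE !(inj_eq f_inj).
  by move=> /orP[]/eqP Ed /orP[]/eqP Ec; move: cd;
    rewrite Ec Ed ?adj_irr // adj_sym.
apply: minor_iso; exists g; first by exists f.
move=> x y; apply/idP/idP => [/f_hom|xy]; first by rewrite !gK.
by have := f_refl (g x, g y); rewrite /= !gK xy => /negbFE.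
Qed.

(** Contraction destroys the two arcs between [x] and [y], and for each common neighbour [w] it
    merges the arcs of [yw] with those of [xw]. *)
Lemma card_arcs_contract (G : sgraph) (x y : G) : adj x y ->
  (#|arcs G| <= #|arcs (contract x y)| + 2 * #|common_nbrs x y|.+1)%N.
Proof.
move=> xy; have xNy := adj_neq _ _ _ xy.
(* The quotient map: the default value of [insubd] is the merged vertex, so it is the image of
   [y]. *)
pose phi a : contract x y := insubd (Sub x xNy) a.
have val_phi a : val (phi a) = if a == y then x else a.
  by rewrite val_insubd if_neg.
pose lost : {set G * G} := [set (y, w) | w in x |: common_nbrs x y] :|:
  [set (w, y) | w in x |: common_nbrs x y].
have lost_l w : adj x w -> adj y w -> (y, w) \in lost.
  by move=> xw yw; rewrite inE imset_f // !inE xw yw orbT.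
have lost_r w : adj x w -> adj y w -> (w, y) \in lost.
  by move=> xw yw; rewrite inE orbC imset_f // !inE xw yw orbT.
have lost_yx : (y, x) \in lost by rewrite inE imset_f // !inE eqxx.
have lost_xy : (x, y) \in lost by rewrite inE orbC imset_f // !inE eqxx.
have card_lost : (#|lost| <= 2 * #|common_nbrs x y|.+1)%N.
  have inj1 : injective (fun w : G => (y, w)) by move=> u v [->].
  have inj2 : injective (fun w : G => (w, y)) by move=> u v [->].
  rewrite (leq_trans (leq_card_setU _ _)) // (card_imset _ inj1).
  by rewrite (card_imset _ inj2) cardsU1 !inE adj_irr /=; lia.
pose Phi (p : G * G) := (phi p.1, phi p.2).
have Phi_inj : {in arcs G :\: lost &, injective Phi}.
  have phi_eq u v : phi u = phi v -> [\/ u = v, u = x /\ v = y | u = y /\ v = x].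
    move/(congr1 val); rewrite !val_phi.
    case: (eqVneq u y) => [->|_]; case: (eqVneq v y) => [->|_] E.
    - exact: Or31.
    - by apply: Or33.
    - by apply: Or32.
    - exact: Or31.
  move=> [a b] [c d]; rewrite ![_ \in arcs G :\: _]in_setD ![_ \in arcs G]inE /=.
  move=> /andP[abNl ab] /andP[cdNl cd] [/phi_eq Eac /phi_eq Ebd].
  (* Apart from loops and arcs between [x] and [y], distinct arcs with equal images share one end
     and have [x] and [y] at the other. The shared end is a common neighbour, so the arc at [y] lies
     in [lost]. *)
  case: Eac abNl ab cdNl cd => [->|[-> ->]|[-> ->]];
    case: Ebd => [->|[-> ->]|[-> ->]] // abNl ab cdNl cd;
    rewrite ?adj_irr ?lost_xy ?lost_yx // in abNl ab cdNl cd.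
  - by case/negP: cdNl; rewrite lost_r // adj_sym.
  - by case/negP: abNl; rewrite lost_r // adj_sym.
  - by case/negP: cdNl; rewrite lost_l.
  - by case/negP: abNl; rewrite lost_l.
rewrite -(cardsID lost (arcs G)) addnC leq_add //; last first.
  by apply: leq_trans card_lost; rewrite subset_leq_card // subsetIr.
rewrite -(card_in_imset Phi_inj) subset_leq_card //.
apply/subsetP=> _ /imsetP[[a b] + ->].
rewrite in_setD ![in X in _ && X]inE /= => /andP[abNl ab].
rewrite inE /= /contract_adj /= -(inj_eq val_inj) !val_phi.
(* Only arcs between [x] and [y] would collapse to loops, and these are in [lost]. *)
case: (eqVneq a y) abNl ab => [->|aNy]; case: (eqVneq b y) => [->|bNy] abNl ab.
- by rewrite adj_irr in ab.
- rewrite eqxx ab orbT andbT.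
  by apply: contraNneq abNl => <-.
- rewrite eqxx ab !orbT andbT.
  by apply: contraNneq abNl => ->.
- by rewrite ab (adj_neq _ _ _ ab).
Qed.

Lemma contract_nonempty (G : sgraph) (x y : G) :
  adj x y -> (0 < #|contract x y|)%N.
Proof. by move=> /adj_neq xNy; apply/card_gt0P; exists (exist _ x xNy). Qed.

Lemma two_common_nbrs_minor (G : sgraph) (x y : G) :
  adj x y -> (1 < #|common_nbrs x y|)%N -> minor K4_minus_e G.
Proof.
move=> xy /card_gt1P[z [w [+ + zNw]]].
rewrite !inE => /andP[xz yz] /andP[xw yw].
(* The missing edge of [K4_minus_e] joins 0 and 3, so the possibly non-adjacent [z] and [w] take the
   end positions. *)
pose s := [:: z; x; y; w].
have s_uniq : uniq s.
  rewrite /= !inE !negb_or zNw (adj_neq _ _ _ xy) (adj_neq _ _ _ xw).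
  by rewrite (adj_neq _ _ _ yw) ![z == _]eq_sym !adj_neq.
apply: (subgraph_minor K4_minus_e G (fun i : 'I_4 => nth z s i)) => [i j /eqP|i j].
  by rewrite nth_uniq // => /eqP/val_inj.
case/andP=> iNj ijN.
have {ijN} [N1 N2] : (val i, val j) <> (0, 3)%N /\ (val i, val j) <> (3, 0)%N.
  split=> -[Ei Ej]; case/eqP: ijN; last rewrite setUC.
    by congr [set _; _]; apply: val_inj.
  by congr [set _; _]; apply: val_inj.
case: i j iNj N1 N2 => [[|[|[|[|i]]]] lti] [[|[|[|[|j]]]] ltj] //= _ _ _.
all: by rewrite // adj_sym.
Qed.

Lemma many_arcs_minor (G : sgraph) :
  (0 < #|G|)%N -> (3 * #|G| <= #|arcs G| + 2)%N -> minor K4_minus_e G.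
Proof.
have [n] := ubnP #|G|; elim: n G => // n IHn G ltGn G_gt0 leG.
have [[x y] /= /andP[xy two]|le1] :=
    pickP [pred p : G * G | adj p.1 p.2 && (1 < #|common_nbrs p.1 p.2|)%N].
  exact: two_common_nbrs_minor two.
have [[x y] /= /andP[xy /eqP none]|gt0] :=
    pickP [pred p : G * G | adj p.1 p.2 && (#|common_nbrs p.1 p.2| == 0)%N].
  (* One vertex, worth 3, is traded for at most 2 arcs. *)
  apply: (minor_contract xy); have := card_arcs_contract _ _ _ xy.
  have := contract_nonempty _ _ _ xy; rewrite none card_contract => ? ?.
  by apply: IHn; rewrite ?card_contract //; lia.
have card_common (a b : G) : adj a b -> #|common_nbrs a b| = 1%N.
  move=> ab; have := le1 (a, b); have := gt0 (a, b); rewrite /= ab /=; lia.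
have common_uniq (a b u v : G) : adj a b ->
    u \in common_nbrs a b -> v \in common_nbrs a b -> u = v.
  by move/card_common/eqP/cards1P=> [t ->]; rewrite !inE => /eqP-> /eqP->.
have [[x y] /= xy|edgeless] := pickP [pred p : G * G | adj p.1 p.2]; last first.
  have E : arcs G = set0 by apply/setP=> p; rewrite !inE; apply: edgeless.
  by move: leG; rewrite E cards0; lia.
have /card_gt0P[z] : (0 < #|common_nbrs x y|)%N by rewrite card_common.
rewrite inE => /andP[xz yz].
have zNy : z != y by rewrite eq_sym (adj_neq _ _ _ yz).
pose G1 := contract x y.
pose x1 : G1 := exist _ x (adj_neq _ _ _ xy).
pose z1 : G1 := exist _ z zNy.
have xz1 : adj x1 z1.
  by rewrite /= /contract_adj /= xz -(inj_eq val_inj) /= (adj_neq _ _ _ xz).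
(* A common neighbour [w] is adjacent to [z] and to [x] or [y]. Since [xz] lies only in the triangle
   with [y], and [yz] only in that with [x], [w] would be [y] or [x]; but [y] is gone and [x] is the
   merged vertex. *)
have none : common_nbrs x1 z1 = set0.
  apply/setP=> w; rewrite [in RHS]inE; apply/negP; rewrite inE => /andP[].
  move=> /[dup] /adj_neq; rewrite -(inj_eq val_inj) /= eq_sym => wNx.
  have wNy : val w != y := valP w.
  rewrite /= /contract_adj /= eqxx (negbTE wNx) /= [z == x]eq_sym.
  rewrite (negbTE (adj_neq _ _ _ xz)) /= !orbF => /andP[_ xyw] /andP[_ zw].
  case/orP: xyw => [xw|yw].
    case/eqP: wNy; apply: (common_uniq x z) => //; rewrite inE ?xw ?xy //.
    by rewrite adj_sym.
  case/eqP: wNx; apply: (common_uniq y z) => //; rewrite inE ?yw //.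
  by rewrite adj_sym xy adj_sym.
(* Collapsing the triangle costs at most 4 + 2 arcs, exactly balanced by 3 for each of the two
   vertices removed. *)
apply: (minor_contract xy); apply: (minor_contract xz1).
have leG1 : (#|arcs G| <= #|arcs G1| + 4)%N.
  by have := card_arcs_contract _ _ _ xy; rewrite card_common.
have leG2 : (#|arcs G1| <= #|arcs (contract x1 z1)| + 2)%N.
  by have := card_arcs_contract _ _ _ xz1; rewrite none cards0.
have G2_gt0 := contract_nonempty _ _ _ xz1.
have cardG2 : #|contract x1 z1| = #|G|.-2 by rewrite !card_contract.
by apply: IHn => //; rewrite cardG2 in G2_gt0 *; lia.
Qed.

Local Open Scope ring_scope.

Theorem corollary1p8 (G : sgraph) (G_nonempty : (0 < nb_vertices G)%N)
    (many_edges :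
      3%:R / 2%:R * (nb_vertices G)%:R - 1 <= (nb_edges G)%:R :> rat) :
  minor K4_minus_e G.
Proof.
apply: many_arcs_minor => //.
have leG : (3 * nb_vertices G <= 2 * nb_edges G + 2)%N.
  by rewrite -(ler_nat rat) natrD !natrM; lra.
by apply: leq_trans leG _; rewrite leq_add2r leq_double_edges_arcs.
Qed.
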